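(* Let $\mu_0$ be the logistic measure on $\mathbb{R}$, with density $\frac{1}{e^{\gamma}+e^{-\gamma}+2}$, and write $\Gamma(X)=\Gamma(X,\mu_0)$. For each $\alpha>1$ there exists $\beta=\beta(\alpha)>0$ such that for all integers $1\le k\le n$ and every non-empty family $X$ of $k$-subsets of $\{1,\ldots,n\}$ with $|X|\ge\alpha^k$ we have $$\beta\,\Gamma(X)\le\ln|X|\le\Gamma(X).$$ Moreover, the $\beta(\alpha)$ can be chosen so that $\beta(\alpha)\longrightarrow 1$ as $\alpha\longrightarrow+\infty$.
   Context: Subsets $x$ of $\{1,\ldots,n\}$ are identified with their indicator vectors in $\{0,1\}^n$. A $k$-subset is a subset with exactly $k$ elements. $|X|$ is the cardinality of $X$. For a symmetric Borel probability measure $\mu$ on $\mathbb{R}$ (i.e. $\mu(A)=\mu(-A)$ for all Borel $A$) with finite variance and a non-empty family $X$ of subsets of $\{1,\ldots,n\}$, $$\Gamma(X,\mu)=\mathbf{E}\max_{x\in X}\sum_{i\in x}\gamma_i,$$ where $\gamma_1,\ldots,\gamma_n$ are independent random variables with distribution $\mu$. The constant $\beta(\alpha)$ depends only on $\alpha$ (not on $n$, $k$ or $X$). *)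

(* Defs.v *)
From HB Require Import structures.
From mathcomp Require Import all_boot all_order all_algebra.
From mathcomp Require Import ring.
From mathcomp Require Import all_classical all_reals all_analysis.
From mathcomp Require Import measurable_realfun.

Set Implicit Arguments.
Unset Strict Implicit.
Unset Printing Implicit Defensive.

Import Order.TTheory GRing.Theory Num.Theory.
Import numFieldNormedType.Exports.

Local Open Scope classical_set_scope.
Local Open Scope ring_scope.

Definition logistic_pdf {R : realType} (x : R) : R :=
  (expR x + expR (- x) + 2)^-1.

Definition logistic_prob {R : realType} (A : set R) : \bar R :=
  (\int[lebesgue_measure]_(x in A) (logistic_pdf x)%:E)%E.

Section logistic.
Context {R : realType}.
Notation mu := (@lebesgue_measure R).

Let den_gt0 (x : R) : 0 < expR x + expR (- x) + 2.
Proof. by rewrite !addr_gt0 ?expR_gt0. Qed.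

Lemma logistic_pdf_ge0 (x : R) : 0 <= logistic_pdf x.
Proof. by rewrite invr_ge0 ltW. Qed.

Let cexpN : continuous (fun x : R => expR (- x)).
Proof.
move=> x; apply: continuous_comp; last exact: continuous_expR.
exact: (@continuousN _ R^o).
Qed.

Lemma continuous_logistic_pdf : continuous (@logistic_pdf R).
Proof.
move=> x; apply: (@continuousV R R^o (fun x : R => expR x + expR (- x) + 2)).
  by rewrite gt_eqF.
apply: cvgD; last exact: cvg_cst.
by apply: cvgD; [exact: continuous_expR|exact: cexpN].
Qed.

Lemma measurable_logistic_pdf : measurable_fun [set: R] (@logistic_pdf R).
Proof. by apply: continuous_measurable_fun; exact: continuous_logistic_pdf. Qed.

Let cdf (x : R) := (1 + expR (- x))^-1.

Let cdf_den (x : R) : 1 + expR (- x) != 0.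
Proof. by rewrite gt_eqF// addr_gt0 ?expR_gt0. Qed.

Let is_derive_cdf (x : R) : is_derive x 1 cdf (logistic_pdf x).
Proof.
have dD : is_derive x 1 (fun y : R => 1 + expR (- y)) (- expR (- x)).
  by apply: is_derive_eq; rewrite add0r mul1r mulrN1.
apply: is_derive_eq.
  exact: (@is_deriveV _ (fun y : R => 1 + expR (- y)) x (- expR (- x)) 1
    (cdf_den x) dD).
have d0 := cdf_den x; have e0 : expR (- x) != 0 :> R by rewrite gt_eqF ?expR_gt0.
have -> : logistic_pdf x = ((expR (- x))^-1 + expR (- x) + 2)^-1.
  by rewrite -expRN opprK.
move: (expR (- x)) d0 e0 => e d0 e0; rewrite /GRing.scale/=.
have -> : e^-1 + e + 2 = (1 + e) ^+ 2 / e by field.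
by field; rewrite d0 e0.
Qed.

Let ccdf : continuous cdf.
Proof.
move=> x; apply: (@continuousV R R^o (fun x : R => 1 + expR (- x))).
  exact: cdf_den.
by apply: cvgD; [exact: cvg_cst|exact: cexpN].
Qed.

Lemma integral_logistic_pdf : (\int[mu]_x (logistic_pdf x)%:E = 1)%E.
Proof.
rewrite ge0_symfun_integralT; last 3 first.
- exact: logistic_pdf_ge0.
- exact: continuous_logistic_pdf.
- by move=> x; rewrite /logistic_pdf /= opprK (addrC (expR x)).
rewrite -set_itvcy (@ge0_continuous_FTC2y _ _ cdf _ 1).
- rewrite /cdf oppr0 expR0 -EFinB -EFinM; congr (_%:E).
  by field.
- by move=> x _; exact: logistic_pdf_ge0.
- exact/continuous_subspaceT/continuous_logistic_pdf.
- rewrite -[X in _ --> X]invr1; apply: cvgV; first exact: oner_neq0.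
  rewrite -[X in _ --> X]addr0; apply: cvgD; first exact: cvg_cst.
  exact: cvgr_expR.
- by move=> x _; have [] := is_derive_cdf x.
- exact/cvg_at_right_filter/ccdf.
- by move=> x _; rewrite derive1E; have [_ ->] := is_derive_cdf x.
Qed.

Local Notation logistic := (@logistic_prob R).

Let logistic0 : logistic set0 = 0%E.
Proof. exact: integral_set0. Qed.

Let logistic_ge0 A : (0 <= logistic A)%E.
Proof. by apply: integral_ge0 => x _; rewrite lee_fin logistic_pdf_ge0. Qed.

Let logistic_sigma_additive : semi_sigma_additive logistic.
Proof.
move=> F mF tF mUF; rewrite /logistic_prob; apply: cvg_toP.
  apply: ereal_nondecreasing_is_cvgn => m n mn.
  by apply: lee_sum_nneg_natr => // k _ _; exact: logistic_ge0.
rewrite ge0_integral_bigcup//=.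
- apply/measurable_funTS/measurableT_comp => //.
  exact: measurable_logistic_pdf.
- by move=> x _; rewrite lee_fin logistic_pdf_ge0.
Qed.

HB.instance Definition _ := isMeasure.Build _ _ _
  logistic logistic0 logistic_ge0 logistic_sigma_additive.

HB.instance Definition _ :=
  @Measure_isProbability.Build _ _ R logistic integral_logistic_pdf.

End logistic.

Definition mutually_independent {R : realType} {d} {T : measurableType d}
    (P : probability T R) (I : finType) (gamma : I -> {RV P >-> R}) : Prop :=
  forall (J : {set I}) (A : I -> set R), (forall i, measurable (A i)) ->
    P (\bigcap_(i in [set` J]) gamma i @^-1` A i) =
    (\prod_(i in J) P (gamma i @^-1` A i))%E.

(* The laws are compared on Borel sets only: elsewhere [mu] and [distribution]
   are unconstrained functions on sets. *)
Definition has_distribution {R : realType} {d} {T : measurableType d}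
    (P : probability T R) (g : {RV P >-> R}) (mu : probability R R) : Prop :=
  forall A, measurable A -> distribution P g A = mu A.

(* E max_{x in X} sum_{i in x} gamma_i, as an extended real so that no
   integrability side condition is hidden. The default value -oo of the maximum
   is irrelevant when X is non-empty. For gamma_1, ..., gamma_n independent with
   distribution mu, this is Gamma(X, mu). *)
Definition Gamma {R : realType} {d} {T : measurableType d}
    (P : probability T R) (n : nat) (gamma : 'I_n -> {RV P >-> R})
    (X : {set {set 'I_n}}) : \bar R :=
  (\int[P]_w \big[maxe/-oo]_(x in X) (\sum_(i in x) gamma i w)%:E)%E.

(* Main.v *)
Require Import Defs.
From mathcomp Require Import all_boot all_order all_algebra.
From mathcomp Require Import ring lra.
From mathcomp Require Import all_classical all_reals all_analysis.
From mathcomp Require Import measurable_realfun.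
Import Order.TTheory GRing.Theory Num.Theory.
Import numFieldNormedType.Exports.

(** Each inequality rests on one estimate for a logistic variable [Z]: the lower
bound on [E max(0, Z - t) = ln (1 + e^-t)], the upper bound on
[E e^(lam Z) <= 2 / (1 - lam)] for [0 <= lam < 1].

Lower bound. Reveal the weights one coordinate at a time, and decide with a
fixed threshold whether to keep the coordinate. Split [X] into the sets that
avoid [i] and those that contain [i]; suppose that sets of score [W0] and [W1]
(without the [i]-th weight [Z]) have been selected in the two parts, with means
[e0] and [e1]. Taking the second one exactly when [Z > t := e0 - e1] yields
[W0 1(Z <= t) + (W1 + Z) 1(Z > t)
   = W0 1(Z <= t) + (W1 + t) 1(Z > t) + max(0, Z - t)].
Both [W0] and [W1 + t] have mean [e0] and are independent of [Z], so the mean is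
[e0 + ln (1 + e^(e1 - e0)) = ln (e^e0 + e^e1)]. The logistic law is the one for
which this recursion is the logarithm of a plain addition, so induction gives a
selection whose mean is at least [ln |X|], and the maximum dominates it
([mean_off_threshold], [exists_selection], [ln_card_le_Gamma]).

Upper bound. For [0 < lam < 1] the usual exponential-moment bound, combined
with independence, gives [Gamma <= (ln |X| + k ln C) / lam] with
[C = 2 / (1 - lam)] ([Gamma_le]). As [k <= ln |X| / ln alpha] and [ln C <= C],
it is enough to let [lam] tend to 1 with [alpha] slowly enough for [C / ln alpha] to vanish;
[lam = 1 / (1 + u)] with [u = 1 / sqrt (ln alpha)] does, and leads to
[1 / beta = (1 + u) (1 + 2 u + 2 u^2)].

The independence that both parts use is that of one coordinate from a function
of other ones. It is expressed by [mean_off]: the mean of the function over any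
box that leaves its coordinates free is proportional to the probability of the
box. *)

Set Implicit Arguments.
Unset Strict Implicit.
Unset Printing Implicit Defensive.

Local Open Scope classical_set_scope.
Local Open Scope ring_scope.

(** * Integrals against a weighted image measure *)

Section change_of_measure.
Context {R : realType} {d d' : measure_display}.
Context {T : measurableType d} {T' : measurableType d'}.
Variables (m : {measure set T -> \bar R}) (nu : {measure set T' -> \bar R}).
Variables (U : T -> R) (Z : T -> T').
Hypotheses (mU : measurable_fun [set: T] U) (U0 : forall w, 0 <= U w).
Hypothesis mZ : measurable_fun [set: T] Z.
Hypothesis nuE : forall B, measurable B ->
  (\int[m]_(w in Z @^-1` B) (U w)%:E = nu B)%E.

Import HBNNSimple.

Let nnsfun_case (h : {nnsfun T' >-> R}) :
  (\int[m]_w (h (Z w) * U w)%:E = \int[nu]_y (h y)%:E)%E.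
Proof.
under [RHS]eq_integral do rewrite fimfunE -fsumEFin//.
rewrite [RHS]ge0_integral_fsum//; last 2 first.
  - by move=> r; exact/measurable_EFinP/measurableT_comp.
  - by move=> n x _; rewrite EFinM nnfun_muleindic_ge0.
have ge0 r w : (0 <= (r * \1_(h @^-1` [set r]) (Z w) * U w)%:E)%E.
  by rewrite EFinM mule_ge0 ?lee_fin// -lee_fin EFinM nnfun_muleindic_ge0.
transitivity (\int[m]_w (\sum_(r \in range h)
    (r * \1_(h @^-1` [set r]) (Z w) * U w)%:E))%E.
  apply: eq_integral => w _; rewrite EFinM fimfunE -fsumEFin//.
  rewrite ge0_mule_fsuml// => r; rewrite EFinM nnfun_muleindic_ge0//.
have mind r : measurable_fun [set: T]
    (fun w => \1_(h @^-1` [set r]) (Z w) * U w : R).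
  apply: measurable_funM => //; apply: measurableT_comp => //.
rewrite ge0_integral_fsum//; last first.
  move=> r; apply/measurable_EFinP.
  by under eq_fun do rewrite -mulrA; exact: measurable_funM.
apply: eq_fsbigr => r /[!inE] -[y _ <-].
rewrite integralZl_indic_nnsfun// integral_indic// setIT.
under eq_integral do rewrite -mulrA EFinM.
rewrite ge0_integralZl//; last 3 first.
  - exact/measurable_EFinP.
  - by move=> w _; rewrite lee_fin mulr_ge0.
  - by rewrite lee_fin.
congr (_ * _)%E; rewrite -nuE// [RHS]integral_mkcond.
apply: eq_integral => w _; rewrite patchE indicE.
have -> : (Z w \in h @^-1` [set h y]) = (w \in Z @^-1` (h @^-1` [set h y])).
  by apply/idP/idP; rewrite !inE.
by case: ifPn => _; rewrite ?mul1r ?mul0r.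
Qed.

(** Covers at once a measure given by a density ([Z] the identity) and the
factorization of a mean over independent variables ([nu] a multiple of the law
of [Z]). The two sides agree on indicators by hypothesis, hence on simple
functions by linearity and on limits of these by monotone convergence. *)
Lemma ge0_integral_change_of_measure (h : T' -> \bar R) :
  measurable_fun [set: T'] h -> (forall y, 0 <= h y)%E ->
  (\int[m]_w (h (Z w) * (U w)%:E) = \int[nu]_y h y)%E.
Proof.
move=> mh h0; pose h_ := nnsfun_approx measurableT mh.
have hcvg y : EFin \o h_ ^~ y @ \oo --> h y by exact: cvg_nnsfun_approx.
have mhU n : measurable_fun [set: T] (fun w => (h_ n (Z w) * U w)%:E).
  by apply/measurable_EFinP; apply: measurable_funM => //; exact: measurableT_comp.
have nd y : {homo h_^~ y : p q / (p <= q)%N >-> p <= q}.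
  by move=> p q pq; exact/lefP/nd_nnsfun_approx.
transitivity (limn (fun n => \int[m]_w (h_ n (Z w) * U w)%:E))%E.
  rewrite -monotone_convergence//.
  - apply: eq_integral => w _; apply/esym/cvg_lim => //=.
    under eq_fun do rewrite EFinM.
    by apply: cvgeZr => //; exact: hcvg.
  - by move=> n w _; rewrite lee_fin mulr_ge0.
  - by move=> w _ p q pq; rewrite lee_fin ler_wpM2r// nd.
transitivity (limn (fun n => \int[nu]_y (h_ n y)%:E))%E.
  by apply: congr_lim; apply/funext => n; exact: nnsfun_case.
rewrite -monotone_convergence//.
- by apply: eq_integral => y _; apply/cvg_lim => //; exact: hcvg.
- by move=> n; exact/measurable_EFinP.
- by move=> n y _; rewrite lee_fin.
- by move=> y _ p q pq; rewrite lee_fin nd.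
Qed.

End change_of_measure.

(** * The logistic law *)

Section logistic_moments.
Context {R : realType}.
Implicit Types (x t lam : R).
Notation leb := (@lebesgue_measure R).
Notation logistic := (@logistic_prob R).

Lemma ge0_integral_logistic_prob (h : R -> R) :
  measurable_fun [set: R] h -> (forall x, 0 <= h x) ->
  (\int[logistic]_x (h x)%:E = \int[leb]_x (h x * logistic_pdf x)%:E)%E.
Proof.
move=> mh h0; apply/esym; under eq_integral do rewrite EFinM.
apply: (@ge0_integral_change_of_measure _ _ _ _ _ leb logistic
  logistic_pdf id) => //.
- exact: measurable_logistic_pdf.
- exact: logistic_pdf_ge0.
- exact/measurable_EFinP.
Qed.

Lemma logistic_pdfN x : logistic_pdf (- x) = logistic_pdf x.
Proof. by rewrite /logistic_pdf opprK (addrC (expR x)). Qed.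

Lemma ge0_integral_lebesgueN (f : R -> R) :
  measurable_fun [set: R] f -> (forall x, 0 <= f x) ->
  (\int[leb]_x (f (- x))%:E = \int[leb]_x (f x)%:E)%E.
Proof.
move=> mf f0.
rewrite -(@ge0_integral_change_of_measure _ _ _ _ _ leb leb (cst 1) -%R
  _ _ _ _ (EFin \o f)) //=.
- by under [RHS]eq_integral do rewrite mule1.
- move=> B mB; rewrite integral_cst//= ?mul1e; first exact: lebesgue_measureN.
  by rewrite -[_ @^-1` _]setTI; exact: oppr_measurable.
- exact/measurable_EFinP.
Qed.

Lemma ge0_integral_logistic_probN (h : R -> R) :
  measurable_fun [set: R] h -> (forall x, 0 <= h x) ->
  (\int[logistic]_x (h (- x))%:E = \int[logistic]_x (h x)%:E)%E.
Proof.
move=> mh h0; rewrite !ge0_integral_logistic_prob//; last first.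
  by apply: measurableT_comp => //; exact: oppr_measurable.
rewrite -[RHS]ge0_integral_lebesgueN.
- by apply: eq_integral => x _; rewrite logistic_pdfN.
- by apply: measurable_funM => //; exact: measurable_logistic_pdf.
- by move=> x; rewrite mulr_ge0// logistic_pdf_ge0.
Qed.

(* An antiderivative of [(x - t) * logistic_pdf x]: integrate by parts against
   the survival function [(1 + expR x)^-1], whose own antiderivative is
   [- ln (1 + expR (- x))]. *)
Let F t x : R := - (x - t) * (1 + expR x)^-1 - ln (1 + expR (- x)).

Let is_derive_F t x : is_derive x 1 (F t) ((x - t) * logistic_pdf x).
Proof.
have e0 : 0 < expR x by exact: expR_gt0.
have d1 : is_derive x 1 (fun y : R => 1 + expR y) (expR x).
  by rewrite -[X in is_derive _ _ _ X]add0r; exact: is_deriveD.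
have d2 : is_derive x 1 (fun y : R => 1 + expR (- y)) (- expR (- x)).
  by apply: is_derive_eq; rewrite add0r mul1r mulrN1.
have d3 : is_derive x 1 (fun y : R => (1 + expR y)^-1)
    (- (1 + expR x) ^- 2 *: expR x).
  by apply: is_deriveV; rewrite gt_eqF// addr_gt0.
have d4 : is_derive x 1 (fun y : R => - (y - t)) (-1).
  by apply: is_derive_eq; rewrite subr0.
have d5 : is_derive x 1 (@ln R \o (fun y : R => 1 + expR (- y)))
    ((1 + expR (- x))^-1 * (- expR (- x))).
  by apply: is_derive1_comp; apply: is_derive1_ln; rewrite addr_gt0 ?expR_gt0.
have dF := is_deriveB (is_deriveM d4 d3) d5.
apply: (is_derive_eq dF).
rewrite /GRing.scale/= /logistic_pdf expRN; move: (expR x) e0 => e e0.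
have en0 : e != 0 by rewrite gt_eqF.
have e1n0 : 1 + e != 0 by rewrite gt_eqF// addr_gt0.
have -> : e + e^-1 + 2 = (1 + e) ^+ 2 / e by field.
by field; rewrite en0 e1n0.
Qed.

(* Since [expR x] exceeds [x ^+ 2 / 2], the first term is [O(1 / x)]. *)
Let cvg_F t : F t x @[x --> +oo] --> 0.
Proof.
rewrite -[0]oppr0 -[X in _ --> X]subr0; apply: cvgB; last first.
  have : 1 + expR (- x) @[x --> +oo] --> (1 + 0 : R).
    by apply: cvgD; [exact: cvg_cst|exact: cvgr_expR].
  rewrite addr0 => cv1; rewrite -[X in _ --> X](@ln1 R).
  exact: cvg_comp cv1 (continuous_ln ltr01).
under eq_fun do rewrite mulNr; apply: cvgN.
have cvgV : 4 * x^-1 @[x --> +oo] --> (0 : R).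
  rewrite -[X in _ --> X](mulr0 4); apply: cvgMl_tmp.
  have V0 : \forall x \near +oo, 0 < (x : R).
    by apply: nbhs_pinfty_gt; exact: num_real.
  by apply: (gtr0_cvgV0 V0).2; exact: cvg_id.
apply: squeeze_cvgr (cvg_cst 0) cvgV; near=> x.
have x0 : 0 < x by near: x; apply: nbhs_pinfty_gt; exact: num_real.
have tx : t <= x by near: x; apply: nbhs_pinfty_ge; exact: num_real.
have Ntx : - t <= x by near: x; apply: nbhs_pinfty_ge; exact: num_real.
have e1 : 0 < 1 + expR x by rewrite addr_gt0 ?expR_gt0.
apply/andP; split; first by rewrite divr_ge0 ?subr_ge0// ltW.
have e2 : x ^+ 2 / 2 <= 1 + expR x.
  have := @expR_ge1Dxn R x 1 (ltW x0); rewrite (_ : 2`! = 2)%N//; lra.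
rewrite ler_pdivrMr// mulrAC ler_pdivlMr//.
by nra.
Unshelve. all: by end_near. Qed.

Lemma logistic_excess t :
  (\int[logistic]_x (Num.max 0 (x - t))%:E = (ln (1 + expR (- t)))%:E)%E.
Proof.
have mpdf := @measurable_logistic_pdf R.
rewrite ge0_integral_logistic_prob//; last 2 first.
- by apply: measurable_maxr => //; exact: measurable_funB.
- by move=> x; rewrite le_max lexx.
transitivity (\int[leb]_(x in `[t, +oo[) ((x - t) * logistic_pdf x)%:E)%E.
  rewrite [RHS]integral_mkcond; apply: eq_integral => x _; rewrite patchE.
  case: ifPn; rewrite ?inE/= ?notin_setE/= in_itv/= andbT.
    by move=> tx; rewrite max_r// subr_ge0.
  by move=> /negP; rewrite -ltNge => xt; rewrite max_l ?mul0r// subr_le0 ltW.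
have cF x : {for x, continuous (F t)}.
  by apply/differentiable_continuous/derivable1_diffP; exact: ex_derive.
rewrite (@ge0_continuous_FTC2y _ _ (F t) _ 0).
- by rewrite /F subrr oppr0 mul0r sub0r sub0e -EFinN opprK.
- by move=> x tx; rewrite mulr_ge0 ?logistic_pdf_ge0// subr_ge0.
- apply/continuous_subspaceT => x.
  apply: cvgM; last exact: continuous_logistic_pdf.
  by apply: cvgB; [exact: cvg_id|exact: cvg_cst].
- exact: cvg_F.
- by move=> x _; exact: ex_derive.
- exact/cvg_at_right_filter/cF.
- by move=> x _; rewrite derive1E; have [_ ->] := is_derive_F t x.
Qed.

(** The density is at most [expR (- `|x|)], so the moment is at most the
integral of [expR (- (1 - lam) * `|x|)]. *)
Lemma logistic_mgf_le lam : 0 <= lam < 1 ->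
  (\int[logistic]_x (expR (lam * x))%:E <= (2 / (1 - lam))%:E)%E.
Proof.
move=> /andP[lam0 lam1]; have c0 : 0 < 1 - lam by rewrite subr_gt0.
have cexp : continuous (fun x : R => expR (- (1 - lam) * `|x|)).
  move=> x; apply: continuous_comp; last exact: continuous_expR.
  by apply: cvgMl_tmp; exact: norm_continuous.
have mexp : measurable_fun [set: R] (fun x : R => expR (lam * x)).
  apply: (measurableT_comp (@measurable_expR R)).
  exact: mulrl_measurable.
rewrite ge0_integral_logistic_prob//.
apply: (@le_trans _ _ (\int[leb]_x (expR (- (1 - lam) * `|x|))%:E)%E).
  apply: ge0_le_integral => //.
  - by move=> x _; rewrite lee_fin mulr_ge0 ?logistic_pdf_ge0 ?expR_ge0.
  - apply/measurable_EFinP; apply: measurable_funM => //.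
    exact: measurable_logistic_pdf.
  - by apply/measurable_EFinP; exact: continuous_measurable_fun.
  - move=> x _; rewrite lee_fin.
    have pdf_le : logistic_pdf x <= expR (- `|x|).
      rewrite expRN lef_pV2 ?posrE ?expR_gt0// ?addr_gt0 ?expR_gt0//.
      have := expR_gt0 x; have := expR_gt0 (- x).
      by case: (ger0P x) => _; lra.
    apply: le_trans (ler_wpM2l (expR_ge0 _) pdf_le) _.
    rewrite -expRD ler_expR; have := ler_norm x.
    by move=> /(ler_wpM2l lam0); lra.
rewrite ge0_symfun_integralT//; last by move=> x; rewrite /= normrN.
rewrite -set_itvcy.
have -> : (\int[leb]_(x in `[0%R, +oo[) (expR (- (1 - lam) * `|x|))%:E =
    \int[leb]_(x in `[0%R, +oo[) (expR (- (1 - lam) * x))%:E)%E.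
  apply: eq_integral => x; rewrite inE/= in_itv/= andbT => x0.
  by rewrite ger0_norm.
pose G (y : R) := - (1 - lam)^-1 * expR (- (1 - lam) * y).
have dG x : is_derive x 1 G (expR (- (1 - lam) * x)).
  have d1 : is_derive x 1 (fun y : R => - (1 - lam) * y) (- (1 - lam)).
    apply: (is_derive_eq (is_deriveZ (- (1 - lam)) (is_derive_id x 1))).
    by rewrite /GRing.scale/= mulr1.
  have d2 := is_deriveZ (- (1 - lam)^-1)
    (is_derive1_comp (is_derive_expR _) d1).
  apply: (is_derive_eq d2).
  by rewrite /GRing.scale/= mulrCA mulrNN mulVf ?mulr1// gt_eqF.
have cG x : {for x, continuous G}.
  by apply/differentiable_continuous/derivable1_diffP; exact: ex_derive.
rewrite (@ge0_continuous_FTC2y _ _ G _ 0).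
- by rewrite /G mulr0 expR0 mulr1 sub0e -EFinN opprK -EFinM.
- by [].
- apply/continuous_subspaceT => x.
  apply: continuous_comp; last exact: continuous_expR.
  by apply: cvgMl_tmp; exact: cvg_id.
- rewrite -[X in _ --> X](mulr0 (- (1 - lam)^-1)); apply: cvgMl_tmp.
  rewrite (_ : (fun x => expR (- (1 - lam) * x)) =
    (fun z => expR (- z)) \o (fun z => (1 - lam) * z)).
    apply: (@cvg_comp _ _ _ _ _ _ (pinfty_nbhs R)); last exact: cvgr_expR.
    exact: gt0_cvgMry.
  by apply/funext => x /=; rewrite mulNr.
- by move=> x _; exact: ex_derive.
- exact/cvg_at_right_filter/cG.
- by move=> x _; rewrite derive1E; have [_ ->] := dG x.
Qed.

End logistic_moments.

(** * Independence of a coordinate from a function of the others *)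

Section box_independence.
Context {R : realType} {d : measure_display} {T : measurableType d}.
Context {P : probability T R} {n : nat} {gamma : 'I_n -> {RV P >-> R}}.
Context {mu : probability R R}.
Hypothesis gamma_indep : mutually_independent gamma.
Hypothesis gamma_law : forall i, has_distribution (gamma i) mu.
Implicit Types (A : 'I_n -> set R) (B : set R) (I J : {set 'I_n}) (i : 'I_n).

Definition box A : set T := [set w | forall i, A i (gamma i w)].

(** [A] with its [i]-th side replaced by [B]: the boxes in use leave side [i]
free, so this is the intersection with the event that the [i]-th variable lies
in [B]. *)
Definition constrain A i B : 'I_n -> set R := fun j => if j == i then B else A j.

Lemma boxE A : box A = \bigcap_(i in [set` [set: 'I_n]%SET]) gamma i @^-1` A i.
Proof.
apply/seteqP; split=> w /= Aw; first by move=> i _; exact: Aw.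
by move=> i; apply: Aw => /=; rewrite finset.in_setT.
Qed.

Lemma measurable_gamma_pre i B : measurable B -> measurable (gamma i @^-1` B).
Proof. by move=> mB; rewrite -[_ @^-1` _]setTI; exact: measurable_funP. Qed.

Lemma measurable_box A : (forall i, measurable (A i)) -> measurable (box A).
Proof.
move=> mA; rewrite boxE; apply: fin_bigcap_measurable.
  exact: finite_finset.
by move=> i _; exact: measurable_gamma_pre.
Qed.

Lemma boxT : box (fun=> setT) = setT.
Proof. by apply/seteqP; split. Qed.

Lemma prob_box A : (forall i, measurable (A i)) ->
  P (box A) = (\prod_i mu (A i))%E.
Proof.
move=> mA; rewrite boxE gamma_indep//.
rewrite (eq_bigl xpredT); last by move=> i; rewrite finset.in_setT.
by apply: eq_bigr => i _; exact: gamma_law.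
Qed.

Lemma measurable_constrain A i B : (forall j, measurable (A j)) -> measurable B ->
  forall j, measurable (constrain A i B j).
Proof. by move=> mA mB j; rewrite /constrain; case: eqP. Qed.

Lemma box_constrain A i B : A i = setT ->
  box (constrain A i B) = box A `&` gamma i @^-1` B.
Proof.
move=> AiT; apply/seteqP; split=> [w Aw|w [Aw Bw] j]; last first.
  by rewrite /constrain; case: eqP => [->|_] //; exact: Aw.
split=> [j|]; last by have := Aw i; rewrite /constrain eqxx.
by have := Aw j; rewrite /constrain; case: eqP => // ->; rewrite AiT.
Qed.

Lemma prob_box_constrain A i B : (forall j, measurable (A j)) -> measurable B ->
  A i = setT -> P (box (constrain A i B)) = (P (box A) * mu B)%E.
Proof.
move=> mA mB AiT; rewrite !prob_box//; last exact: measurable_constrain.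
rewrite (bigD1 i)//= [in RHS](bigD1 i)//= AiT probability_setT mul1e muleC.
rewrite /constrain eqxx; congr (_ * _)%E.
by apply: eq_bigr => j /negbTE ->.
Qed.

(** [W] has mean [e], also conditionally on the variables outside [I]. This is
weaker than being a function of the variables indexed by [I], but linear in
[W] and stable under the constructions below, which spares generated
sigma-algebras. *)
Definition mean_off I (W : T -> R) (e : R) : Prop :=
  P.-integrable setT (EFin \o W) /\
  forall A, (forall i, measurable (A i)) -> (forall i, i \in I -> A i = setT) ->
    (\int[P]_(w in box A) (W w)%:E = e%:E * P (box A))%E.

Lemma mean_off_expectation I W e : mean_off I W e -> (\int[P]_w (W w)%:E = e%:E)%E.
Proof.
move=> [_ /(_ (fun=> setT))]; rewrite boxT probability_setT mule1; exact.
Qed.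

Lemma mean_off_sub I J W e : (I \subset J)%SET -> mean_off I W e -> mean_off J W e.
Proof.
move=> /fintype.subsetP IJ [iW WE]; split=> // A mA AT.
by apply: WE => // i /IJ; exact: AT.
Qed.

Lemma eq_mean_off I W W' e e' : W =1 W' -> e = e' ->
  mean_off I W e -> mean_off I W' e'.
Proof. by move=> /funext -> ->. Qed.

Lemma mean_off_cst I c : mean_off I (fun=> c) c.
Proof.
split; first exact: finite_measure_integrable_cst.
by move=> A mA _; rewrite integral_cst//; exact: measurable_box.
Qed.

Lemma mean_offD I W1 W2 e1 e2 : mean_off I W1 e1 -> mean_off I W2 e2 ->
  mean_off I (fun w => W1 w + W2 w) (e1 + e2).
Proof.
move=> [i1 E1] [i2 E2]; split.
  by apply: eq_integrable (integrableD _ i1 i2).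
move=> A mA AT; have mbA := measurable_box mA.
rewrite (eq_integral (fun w => (W1 w)%:E + (W2 w)%:E)%E)//.
rewrite integralD_EFin//; last 2 first.
- exact: integrableS i1.
- exact: integrableS i2.
by rewrite E1// E2// EFinD muleDl// fin_num_measure.
Qed.

Lemma mean_offN I W e : mean_off I W e -> mean_off I (fun w => - W w) (- e).
Proof.
move=> [iW EW]; split.
  by apply: eq_integrable (integrableN iW).
move=> A mA AT; have mbA := measurable_box mA.
rewrite (eq_integral (fun w => - (W w)%:E)%E)// integralN/=.
  by rewrite EW// EFinN mulNe.
by apply: integrable_add_def => //; exact: integrableS iW.
Qed.

Lemma mean_off_restrict I i W e B : i \notin I -> measurable B ->
  mean_off I W e ->
  mean_off (i |: I)%SET (fun w => W w * \1_B (gamma i w)) (e * fine (mu B)).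
Proof.
move=> iI mB [iW EW]; have mZB := measurable_gamma_pre i mB.
have WE : EFin \o (fun w => W w * \1_B (gamma i w)) =
    (EFin \o W) \_ (gamma i @^-1` B).
  apply/funext => w; rewrite patchE /= indicE.
  have -> : (gamma i w \in B) = (w \in gamma i @^-1` B).
    by apply/idP/idP; rewrite !inE.
  by case: ifPn => _; rewrite ?mulr1 ?mulr0.
split.
  rewrite WE; apply/(integrable_mkcond _ mZB).1.
  exact: integrableS iW.
move=> A mA AT; have mbA := measurable_box mA.
have AiT : A i = setT by apply: AT; rewrite !inE eqxx.
rewrite (eq_integral ((EFin \o W) \_ (gamma i @^-1` B))); last first.
  by move=> w _; rewrite -WE.
rewrite -integral_mkcondr -box_constrain// EW.
- rewrite prob_box_constrain// EFinM fineK ?fin_num_measure//.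
  by rewrite -muleA; congr (_ * _)%E; rewrite muleC.
- exact: measurable_constrain.
- move=> j jI; rewrite /constrain; case: eqP => [ji|_]; last first.
    by apply: AT; rewrite !inE jI orbT.
  by move: iI; rewrite -ji jI.
Qed.

(** On a box that leaves side [i] free, the image of [U] times the probability
under the [i]-th variable is a multiple of [mu], because a constraint on that
variable just shrinks the box. *)
Lemma mean_off_mul I i U e (h : R -> R) c : i \notin I ->
  mean_off I U e -> (forall w, 0 <= U w) ->
  measurable_fun setT h -> (forall x, 0 <= h x) ->
  (\int[mu]_x (h x)%:E = c%:E)%E ->
  mean_off (i |: I)%SET (fun w => U w * h (gamma i w)) (e * c).
Proof.
move=> iI UE U0 mh h0 hc; have [iU EU] := UE.
have e0 : 0 <= e.
  rewrite -lee_fin -(mean_off_expectation UE).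
  by apply: integral_ge0 => w _; rewrite lee_fin.
have mU : measurable_fun setT U by apply/measurable_EFinP; case/integrableP: iU.
have mhZ : measurable_fun setT (fun w => h (gamma i w)).
  exact: measurableT_comp.
have main A : (forall j, measurable (A j)) ->
    (forall j, j \in (i |: I)%SET -> A j = setT) ->
    (\int[P]_(w in box A) (U w * h (gamma i w))%:E = (e * c)%:E * P (box A))%E.
  move=> mA AT; have mbA := measurable_box mA.
  have AiT : A i = setT by apply: AT; rewrite !inE eqxx.
  have eP0 : 0 <= e * fine (P (box A)) by rewrite mulr_ge0// fine_ge0.
  rewrite integral_mkcond.
  rewrite (eq_integral (fun w => (h (gamma i w))%:E * (U w * \1_(box A) w)%:E)%E);
    last first.
    move=> w _; rewrite patchE indicE -EFinM; case: ifPn => _; first by rewrite mulr1 mulrC.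
    by rewrite !mulr0.
  rewrite (@ge0_integral_change_of_measure _ _ _ _ _ P
    (mscale (NngNum eP0) mu) _ _ _ _ _ _ (EFin \o h))//=.
  - rewrite ge0_integral_mscale//=; last 2 first.
    + exact/measurable_EFinP.
    + by move=> x _; rewrite lee_fin.
    rewrite hc !EFinM fineK ?fin_num_measure//.
    by rewrite -!muleA; congr (_ * _)%E; rewrite muleC.
  - by apply: measurable_funM => //; exact: measurable_indic.
  - by move=> w; rewrite mulr_ge0.
  - move=> B mB; have mZB := measurable_gamma_pre i mB.
    rewrite /mscale/= EFinM fineK ?fin_num_measure// -muleA -(prob_box_constrain mA mB AiT).
    rewrite -EU.
    + rewrite box_constrain// setIC integral_mkcondr.
      apply: eq_integral => w _; rewrite patchE indicE.
      by case: ifPn => _; rewrite ?mulr1 ?mulr0.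
    + exact: measurable_constrain.
    + move=> j jI; rewrite /constrain; case: eqP => [ji|_]; last first.
        by apply: AT; rewrite !inE jI orbT.
      by move: iI; rewrite -ji jI.
  - exact/measurable_EFinP.
split=> //; apply/integrableP; split.
  by apply/measurable_EFinP; exact: measurable_funM.
have := main (fun=> setT); rewrite boxT probability_setT mule1 => mainT.
under eq_integral do rewrite /= ger0_norm ?mulr_ge0//.
by rewrite mainT// ltry.
Qed.

Lemma mean_off_coord i (h : R -> R) c : measurable_fun setT h ->
  (forall x, 0 <= h x) -> (\int[mu]_x (h x)%:E = c%:E)%E ->
  mean_off [set i]%SET (fun w => h (gamma i w)) c.
Proof.
move=> mh h0 hc; have i0 : i \notin (finset.set0 : {set 'I_n}) by rewrite inE.
have := mean_off_mul i0 (mean_off_cst finset.set0 1) (fun=> ler01) mh h0 hc.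
by rewrite finset.setU0 mul1r; under eq_fun do rewrite mul1r.
Qed.

End box_independence.

(** * The threshold selection *)

Section selection.
Context {R : realType} {d : measure_display} {T : measurableType d}.
Context {P : probability T R} {n : nat} {gamma : 'I_n -> {RV P >-> R}}.
Hypothesis gamma_indep : mutually_independent gamma.
Hypothesis gamma_law : forall i, has_distribution (gamma i) (@logistic_prob R).
Implicit Types (I x : {set 'I_n}) (X : {set {set 'I_n}}) (i : 'I_n).

Local Notation mean_off := (@mean_off R d T P n gamma).

Definition score x w : R := \sum_(i in x) gamma i w.

Definition selects X (W : T -> R) : Prop :=
  forall w, exists2 x, x \in X & W w <= score x w.

Let measurable_excess t : measurable_fun setT (fun x : R => Num.max 0 (x - t)).
Proof. by apply: measurable_maxr => //; exact: measurable_funB. Qed.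

Let excess_ge0 t (x : R) : 0 <= Num.max 0 (x - t).
Proof. by rewrite le_max lexx. Qed.

Lemma mean_off_excess i t :
  mean_off [set i]%SET (fun w => Num.max 0 (gamma i w - t)) (ln (1 + expR (- t))).
Proof.
exact: (mean_off_coord gamma_indep gamma_law i (measurable_excess t)
  (excess_ge0 t) (logistic_excess t)).
Qed.

(** The positive and negative parts have the same mean by symmetry of the law. *)
Lemma mean_off_logistic i : mean_off [set i]%SET (gamma i) 0.
Proof.
have pos := mean_off_excess i 0.
have neg : mean_off [set i]%SET (fun w => Num.max 0 (- gamma i w - 0))
    (ln (1 + expR (- 0))).
  apply: (mean_off_coord gamma_indep gamma_law i
    (measurableT_comp (measurable_excess 0) (@oppr_measurable R setT))) => /=.
  - by move=> x; exact: excess_ge0.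
  - rewrite (ge0_integral_logistic_probN (measurable_excess 0))//.
    exact: logistic_excess.
apply: eq_mean_off (mean_offD pos (mean_offN neg)); last by rewrite oppr0 subrr.
move=> w; rewrite !subr0.
have [g0|g0] := leP 0 (gamma i w).
- by rewrite max_l ?oppr_le0// subr0.
- by rewrite max_r ?oppr_ge0 ?(ltW g0)// add0r opprK.
Qed.

(** The threshold [e0 - e1] equalizes the conditional means of [W0] and
[W1 + t], so that the probability of passing it cancels out; what remains is the
mean excess of the [i]-th variable. *)
Lemma mean_off_threshold I i W0 W1 e0 e1 : i \notin I ->
  mean_off I W0 e0 -> mean_off I W1 e1 ->
  exists2 W, mean_off (i |: I)%SET W (ln (expR e0 + expR e1)) &
    forall w, W w = W0 w \/ W w = W1 w + gamma i w.
Proof.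
move=> iI M0 M1; pose t := e0 - e1; pose B : set R := `]-oo, t]%classic.
have mB : measurable B by exact: measurable_itv.
have mB' : measurable (~` B) by exact: measurableC.
have N0 := mean_off_restrict gamma_indep gamma_law iI mB M0.
have N1 := mean_off_restrict gamma_indep gamma_law iI mB'
  (mean_offD M1 (mean_off_cst _ t)).
have E := mean_off_sub (finset.subsetUl [set i]%SET I) (mean_off_excess i t).
exists (fun w => W0 w * \1_B (gamma i w) + (W1 w + t) * \1_(~` B) (gamma i w) +
                 Num.max 0 (gamma i w - t)).
  apply: eq_mean_off (mean_offD (mean_offD N0 N1) E) => //.
  have -> : e1 + t = e0 by rewrite /t addrC subrK.
  rewrite -mulrDr -fineD ?fin_num_measure// probability_setC//.
  rewrite addeC subeK ?fin_num_measure// mulr1 /t opprB.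
  rewrite -{1}(expRK e0) -lnM ?posrE ?expR_gt0 ?addr_gt0 ?expR_gt0//.
  by rewrite mulrDr mulr1 -expRD addrCA subrr addr0.
move=> w; rewrite !indicE in_setC.
have -> : (gamma i w \in B) = (gamma i w <= t).
  by apply/idP/idP; rewrite inE /B set_itvE.
case: leP => gt /=; [left|right].
- by rewrite max_l ?subr_le0// mulr0 mulr1 !addr0.
- rewrite max_r ?subr_ge0 ?ltW// mulr0 mulr1 add0r.
  by rewrite addrACA subrr addr0.
Qed.

(** Induction on [I]: with [Xo] the sets avoiding [i] and [X1] the sets
containing it, with [i] removed, [|X| = |Xo| + |X1|] matches the recursion of
[mean_off_threshold]. When one part is empty there is nothing to choose, and the
mean does not change because the logistic variable is centered. *)
Lemma exists_selection I X : X != finset.set0 -> (forall x, x \in X -> x \subset I) ->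
  exists W e, [/\ mean_off I W e, ln #|X|%:R <= e & selects X W].
Proof.
have scoreD1 i x w : i \in x -> score x w = score (x :\ i)%SET w + gamma i w.
  by move=> ix; rewrite /score (big_setD1 i)//= addrC.
elim: {I}_.+1 {-2}I (ltnSn #|I|) X => // m IH I; rewrite ltnS => Im X X0 XI.
have [I0|/set0Pn[i iI]] := eqVneq I finset.set0.
  have XE : X = [set finset.set0]%SET.
    apply/eqP; rewrite finset.eqEsubset finset.sub1set.
    have Xs : (X \subset [set finset.set0])%SET.
      apply/fintype.subsetP => x /XI; rewrite I0 finset.subset0 => /eqP ->.
      by rewrite inE.
    rewrite Xs; have /set0Pn[x xX] := X0.
    by move/fintype.subsetP: Xs => /(_ _ xX); rewrite inE => /eqP <-.
  exists (fun=> 0), 0; split; first exact: mean_off_cst.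
  - by rewrite XE cards1 ln1.
  - by move=> w; exists finset.set0; rewrite ?XE ?inE// /score big_set0.
pose I' := (I :\ i)%SET; have iI' : i \notin I' by rewrite !inE eqxx.
have II' : (i |: I')%SET = I by rewrite finset.setD1K.
have I'm : (#|I'| < m)%N.
  by apply: leq_trans Im; rewrite (finset.cardsD1 i I) iI.
pose With := [set x : {set 'I_n} | i \in x]%SET.
pose Xo := (X :\: With)%SET; pose X1 := [set x :\ i | x in X :&: With]%SET.
have cardX : #|X| = (#|X1| + #|Xo|)%N.
  rewrite -(finset.cardsID With X) card_in_imset// => x y.
  rewrite !inE => /andP[_ ix] /andP[_ iy] xy.
  by rewrite -(finset.setD1K ix) xy finset.setD1K.
have XoI x : x \in Xo -> x \subset I'.
  rewrite !inE => /andP[ix xX]; apply/fintype.subsetP => j jx.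
  rewrite !inE (fintype.subsetP (XI _ xX))// andbT.
  by apply: contraNneq ix => <-.
have X1I x : x \in X1 -> x \subset I'.
  by move=> /imsetP[y]; rewrite inE => /andP[yX _] ->; exact/finset.setSD/XI.
have X1X x : x \in X1 -> exists2 y, y \in X &
    forall w, score y w = score x w + gamma i w.
  move=> /imsetP[y]; rewrite !inE => /andP[yX iy] ->.
  by exists y => // w; exact: scoreD1.
have XoX x : x \in Xo -> x \in X by rewrite inE => /andP[].
have [X10|X10] := eqVneq X1 finset.set0.
  have Xo0 : Xo != finset.set0.
    by apply: contraNneq X0 => Xo0; rewrite -cards_eq0 cardX X10 Xo0 !cards0.
  have [W [e [We eX sW]]] := IH _ I'm _ Xo0 XoI.
  exists W, e; split.
  - by apply: mean_off_sub We; exact: finset.subD1set.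
  - by rewrite cardX X10 cards0 add0n.
  - by move=> w; have [x /XoX xX Wx] := sW w; exists x.
have [W1 [e1 [M1 eX1 sW1]]] := IH _ I'm _ X10 X1I.
have [Xo0|Xo0] := eqVneq Xo finset.set0.
  exists (fun w => W1 w + gamma i w), (e1 + 0); split.
  - apply: mean_offD; first by apply: mean_off_sub M1; exact: finset.subD1set.
    by apply: mean_off_sub (mean_off_logistic i); rewrite finset.sub1set.
  - by rewrite cardX Xo0 cards0 addn0 addr0.
  - move=> w; have [x /X1X[y yX yE] Wx] := sW1 w.
    by exists y => //; rewrite yE lerD2r.
have [Wo [eo [Mo eXo sWo]]] := IH _ I'm _ Xo0 XoI.
have [W MW WE] := mean_off_threshold iI' Mo M1.
exists W, (ln (expR eo + expR e1)); split; first by rewrite -II'.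
- rewrite ler_ln ?posrE ?addr_gt0 ?expR_gt0 ?ltr0n ?card_gt0//.
  have card_le (Y : {set {set 'I_n}}) e : Y != finset.set0 ->
      ln #|Y|%:R <= e -> #|Y|%:R <= expR e :> R.
    by move=> Y0 Ye; rewrite -[leLHS]lnK ?ler_expR// posrE ltr0n card_gt0.
  by rewrite cardX natrD addrC lerD// card_le.
- move=> w; have [->|->] := WE w.
    by have [x /XoX xX Wx] := sWo w; exists x.
  have [x /X1X[y yX yE] Wx] := sW1 w.
  by exists y => //; rewrite yE lerD2r.
Qed.

End selection.

(** * The expected maximum *)

Section expected_maximum.
Context {R : realType} {d : measure_display} {T : measurableType d}.
Context {P : probability T R} {n : nat} {gamma : 'I_n -> {RV P >-> R}}.
Hypothesis gamma_indep : mutually_independent gamma.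
Hypothesis gamma_law : forall i, has_distribution (gamma i) (@logistic_prob R).
Implicit Types (I x : {set 'I_n}) (X : {set {set 'I_n}}) (i : 'I_n).

Local Notation mean_off := (@mean_off R d T P n gamma).
Local Notation score := (@score R d T P n gamma).

Lemma integrable_score x : P.-integrable setT (fun w => (score x w)%:E).
Proof.
apply: (eq_integrable _ (fun w => \sum_(i in x) (gamma i w)%:E)%E) => //.
  by move=> w _; rewrite /score sumEFin.
apply: integrable_sum => // i _.
by have [] := mean_off_logistic gamma_indep gamma_law i.
Qed.

Definition max_score X w : \bar R := \big[maxe/-oo%E]_(x in X) (score x w)%:E.

Lemma integrable_max_score X : X != finset.set0 ->
  P.-integrable setT (max_score X).
Proof.
move=> /set0Pn[x0 x0X].
apply: (le_integrable _ _ _ (g := fun w => \sum_(x in X) `|(score x w)%:E|)%E) => //.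
- rewrite /max_score; elim: (index_enum _) => [|x s IH].
    by under eq_fun do rewrite big_nil; exact: measurable_cst.
  have [xX|/negbTE xX] := boolP (x \in X); last first.
    by under eq_fun do rewrite big_cons xX.
  under eq_fun do rewrite big_cons xX; apply: measurable_maxe => //.
  by have /integrableP[] := integrable_score x.
- move=> w _; have sum_ge x : x \in X ->
      (`|(score x w)%:E| <= \sum_(x in X) `|(score x w)%:E|)%E.
    by move=> xX; rewrite (bigD1 x)//= leeDl// sume_ge0.
  rewrite [leRHS]gee0_abs ?sume_ge0//.
  have [max0|max0] := leP 0%E (max_score X w).
    rewrite gee0_abs//; apply/bigmax_leP; split => [|x xX]; first by rewrite leNye.
    exact: le_trans (lee_abs _) (sum_ge _ xX).
  rewrite lte0_abs//; apply: le_trans (sum_ge _ x0X).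
  rewrite -abseN; apply: le_trans (lee_abs _).
  by rewrite leeN2; apply: le_bigmax_cond.
- by apply: integrable_sum => // x _; exact: integrable_abse (integrable_score x).
Qed.

Lemma ln_card_le_Gamma X : X != finset.set0 -> ((ln #|X|%:R)%:E <= Gamma gamma X)%E.
Proof.
move=> X0.
have [W [e [We eX sW]]] := exists_selection gamma_indep gamma_law X0
  (fun x _ => finset.subsetT x).
apply: (@le_trans _ _ e%:E); first by rewrite lee_fin.
rewrite -(mean_off_expectation We); apply: le_integral => //.
- by case: We.
- exact: integrable_max_score.
- move=> w _; have [x xX Wx] := sW w.
  by apply: (@le_trans _ _ (score x w)%:E); [rewrite lee_fin|exact: le_bigmax_cond].
Qed.

(** The exponential of the score is a product over the coordinates in [x], so
its mean is the [#|x|]-th power of the moment of one variable. *)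
Lemma mean_off_exp_score (lam : R) x : 0 <= lam < 1 ->
  exists2 e, mean_off x (fun w => expR (lam * score x w)) e &
             e <= (2 / (1 - lam)) ^+ #|x|.
Proof.
move=> lam01; pose h (z : R) := expR (lam * z).
have mh : measurable_fun setT h.
  by apply: (measurableT_comp (@measurable_expR R)); exact: mulrl_measurable.
have h0 z : 0 <= h z by exact: expR_ge0.
have mgf_le := logistic_mgf_le lam01.
have [M Mh] : exists M, (\int[@logistic_prob R]_z (h z)%:E = M%:E)%E.
  exists (fine (\int[@logistic_prob R]_z (h z)%:E)); rewrite fineK//.
  rewrite ge0_fin_numE; first exact: le_lt_trans mgf_le (ltry _).
  by apply: integral_ge0 => z _; rewrite lee_fin.
rewrite -/h Mh lee_fin in mgf_le.
have M0 : 0 <= M.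
  by rewrite -lee_fin -Mh; apply: integral_ge0 => z _; rewrite lee_fin.
have prodM s : uniq s -> mean_off [set i in s]%SET
    (fun w => \prod_(i <- s) h (gamma i w)) (M ^+ size s).
  elim: s => [_|i s IH /= /andP[si us]].
    rewrite expr0; apply: eq_mean_off (mean_off_cst _ 1) => // w.
    by rewrite big_nil.
  have iI : i \notin [set j in s]%SET by rewrite inE.
  have := mean_off_mul gamma_indep gamma_law iI (IH us) _ mh h0 Mh.
  rewrite -set_cons => H; apply: eq_mean_off (H _) => [w||w].
  - by rewrite big_cons mulrC.
  - by rewrite exprSr.
  - by apply: prodr_ge0 => j _; exact: h0.
exists (M ^+ #|x|); last by apply: lerXn2r; rewrite ?nnegrE// (le_trans M0).
have := prodM (enum x) (enum_uniq _); rewrite -cardE set_enum => H.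
apply: eq_mean_off H => // w.
by rewrite big_enum/= -expR_sum mulr_sumr.
Qed.

(** The exponential-moment bound. Instead of applying Jensen to the logarithm,
each score is bounded through the tangent of [ln] at [c], an upper bound for the mean
of the sum [Y] of the exponentials: [lam * s <= ln c - 1 + expR (lam * s) / c].
The right-hand side is then enlarged to one that does not depend on the set, and
it remains affine in [Y]. *)
Lemma Gamma_le (lam : R) k X : 0 < lam < 1 -> X != finset.set0 ->
  (forall x, x \in X -> #|x| = k) ->
  (Gamma gamma X <= (lam^-1 * (ln #|X|%:R + k%:R * ln (2 / (1 - lam))))%:E)%E.
Proof.
move=> /andP[lam0 lam1] X0 Xk; set C := 2 / (1 - lam).
have C0 : 0 < C by rewrite divr_gt0// subr_gt0.
have N0 : 0 < #|X|%:R :> R by rewrite ltr0n card_gt0.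
pose c := #|X|%:R * C ^+ k; have c0 : 0 < c by rewrite mulr_gt0// exprn_gt0.
have lnc : ln c = ln #|X|%:R + k%:R * ln C.
  by rewrite /c lnM ?posrE ?exprn_gt0// lnXn// mulr_natl.
rewrite -lnc; pose U x w := expR (lam * score x w).
have intU x : P.-integrable setT (fun w => (U x w)%:E) /\
    (\int[P]_w (U x w)%:E <= (C ^+ #|x|)%:E)%E.
  have [|e Ue eC] := @mean_off_exp_score lam x; first by rewrite ltW.
  by split; [case: Ue|rewrite (mean_off_expectation Ue) lee_fin].
pose a := lam^-1 * (ln c - 1); pose b := (lam * c)^-1.
have b0 : 0 <= b by rewrite invr_ge0 mulr_ge0 ?ltW.
have bound x w : score x w <= a + b * U x w.
  have := expR_ge1Dx (lam * score x w - ln c).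
  rewrite expRB lnK ?posrE// -/(U x w) => tangent.
  rewrite /a /b invfM -mulrA -mulrDr ler_pdivlMl//; lra.
pose Y w := (\sum_(x in X) (U x w)%:E)%E.
have iY : P.-integrable setT Y by apply: integrable_sum => // x _; exact: (intU x).1.
have EY : (\int[P]_w Y w <= c%:E)%E.
  rewrite integral_sum//; last by move=> x; exact: (intU x).1.
  apply: (@le_trans _ _ (\sum_(x in X) (C ^+ k)%:E)%E).
    by apply: lee_sum => x xX; rewrite -(Xk _ xX); exact: (intU x).2.
  by rewrite sumEFin sumr_const lee_fin /c mulr_natl.
apply: (@le_trans _ _ (\int[P]_w (a%:E + b%:E * Y w))%E).
  apply: le_integral => //.
  - exact: integrable_max_score.
  - apply: integrableD => //; first exact: finite_measure_integrable_cst.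
    exact: integrableZl.
  - move=> w _; apply/bigmax_leP; split => [|x xX]; first by rewrite leNye.
    apply: (@le_trans _ _ (a + b * U x w)%:E); first by rewrite lee_fin bound.
    rewrite EFinD [(b * _)%:E]EFinM; apply: leeD2l; apply: lee_wpmul2l.
      by rewrite lee_fin.
    by rewrite /Y (bigD1 x)//= leeDl// sume_ge0// => y _; rewrite lee_fin expR_ge0.
rewrite integralD//; last 2 first.
- exact: finite_measure_integrable_cst.
- exact: integrableZl.
rewrite (mean_off_expectation (mean_off_cst (gamma := gamma) finset.set0 a)).
rewrite integralZl//.
apply: (@le_trans _ _ (a%:E + b%:E * c%:E)%E).
  by apply: leeD2l; apply: lee_wpmul2l; rewrite ?lee_fin.
by rewrite -EFinM -EFinD lee_fin /a /b invfM mulrBr mulr1 -mulrA mulVf ?mulr1 ?subrK// gt_eqF.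
Qed.

End expected_maximum.

Theorem corollary3p2 (R : realType) :
  exists beta : R -> R,
    (forall alpha : R, 1 < alpha ->
       0 < beta alpha /\
       forall (n k : nat) (X : {set {set 'I_n}}),
         (1 <= k <= n)%N ->
         X != finset.set0 ->
         (forall x : {set 'I_n}, x \in X -> #|x| = k) ->
         alpha ^+ k <= #|X|%:R ->
         forall (d : measure_display) (T : measurableType d)
           (P : probability T R) (gamma : 'I_n -> {RV P >-> R}),
           mutually_independent gamma ->
           (forall i : 'I_n, has_distribution (gamma i) (@logistic_prob R)) ->
           ((beta alpha)%:E * Gamma gamma X <= (ln #|X|%:R)%:E)%E /\
           ((ln #|X|%:R)%:E <= Gamma gamma X)%E)
    /\ beta alpha @[alpha --> +oo] --> (1 : R).
Proof.
pose u (alpha : R) := (Num.sqrt (ln alpha))^-1.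
exists (fun alpha => ((1 + u alpha) * (1 + 2 * u alpha + 2 * u alpha ^+ 2))^-1).
split=> [alpha alpha1|].
  have alpha0 : 0 < alpha by exact: lt_trans alpha1.
  have L0 : 0 < ln alpha by exact: ln_gt0.
  have u0 : 0 < u alpha by rewrite invr_gt0 sqrtr_gt0.
  have u2 : (ln alpha)^-1 = u alpha ^+ 2 by rewrite /u exprVn sqr_sqrtr// ltW.
  move: (u alpha) u0 u2 => v v0 v2.
  have D0 : 0 < (1 + v) * (1 + 2 * v + 2 * v ^+ 2) by nra.
  split; first by rewrite invr_gt0.
  move=> n k X kn X0 Xk Xalpha d T P gamma indep law.
  split; last exact: ln_card_le_Gamma.
  have lam01 : 0 < (1 + v)^-1 < 1 by rewrite invr_gt0 invf_lt1; lra.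
  apply: le_trans (lee_wpmul2l _ (Gamma_le indep law lam01 X0 Xk)) _.
    by rewrite lee_fin invr_ge0 ltW.
  rewrite -EFinM lee_fin mulrC ler_pdivrMr// invrK.
  set N := ln #|X|%:R.
  have C0 : 0 < 2 / (1 - (1 + v)^-1).
    by rewrite divr_gt0// subr_gt0; case/andP: lam01.
  have CE : 2 / (1 - (1 + v)^-1) = 2 * (1 + v) / v by field; rewrite !gt_eqF; lra.
  have kL : k%:R * ln alpha <= N.
    by rewrite mulr_natl -lnXn// ler_ln ?posrE ?exprn_gt0// ltr0n card_gt0.
  have kv : k%:R <= N * v ^+ 2 by rewrite -v2 ler_pdivlMr.
  rewrite [leRHS]mulrCA ler_pM2l; last by lra.
  have : k%:R * ln (2 / (1 - (1 + v)^-1)) <= N * v ^+ 2 * (2 * (1 + v) / v).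
    rewrite -CE; apply: (@le_trans _ _ (k%:R * (2 / (1 - (1 + v)^-1)))).
      by apply: ler_wpM2l => //; apply/ltW/ln_sublinear.
    by apply: ler_wpM2r => //; exact: ltW.
  have -> : N * v ^+ 2 * (2 * (1 + v) / v) = N * (2 * v + 2 * v ^+ 2).
    by field; rewrite gt_eqF.
  lra.
have u0 : u alpha @[alpha --> +oo] --> (0 : R).
  have sqrt_gt0 : \forall alpha \near +oo, 0 < Num.sqrt (ln (alpha : R)).
    apply: filterS (nbhs_pinfty_gt (num_real 1)) => alpha alpha1.
    by rewrite sqrtr_gt0 ln_gt0.
  apply: (gtr0_cvgV0 sqrt_gt0).2; apply/cvgryPge => A.
  apply: filterS (nbhs_pinfty_ge (num_real (expR (A ^+ 2)))) => alpha A2.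
  have alpha0 : 0 < alpha by apply: lt_le_trans A2; exact: expR_gt0.
  apply: le_trans (ler_norm A) _; rewrite -sqrtr_sqr ler_wsqrtr//.
  by rewrite -[leLHS]expRK ler_ln// posrE expR_gt0.
rewrite -[X in _ --> X]invr1; apply: cvgV; first exact: oner_neq0.
rewrite [X in _ --> X](_ : 1 = (1 + 0) * (1 + 2 * 0 + 2 * 0 ^+ 2)); last by ring.
apply: cvgM; first by apply: cvgD; [exact: cvg_cst|exact: u0].
apply: cvgD; first apply: cvgD.
- exact: cvg_cst.
- exact: cvgMl_tmp.
- by apply: cvgMl_tmp; under eq_fun do rewrite expr2; rewrite expr2; exact: cvgM.
Qed.
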